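(* Let $f:\Omega\to\Omega$ be a monotone function (that is, $f\in\Omega^{\mathrm{mon}}_{o\to o}$). Then for all countable ordinals $\alpha$ and $\gamma$: (1) $I_\alpha^{o} f\circ I_\gamma^{o} f = I_{\gamma+\alpha}^{o} f$; (2) $I_\alpha^{o}(I_\gamma^{o} f) = I_{\gamma\alpha}^{o} f$; (3) $I_\alpha^{o\to o}(I_\gamma^{o})\,f = I_{\gamma^\alpha}^{o} f$. Here $\gamma+\alpha$, $\gamma\alpha$, $\gamma^\alpha$ are ordinal sum, product and power.
   Context: $\Omega$ is the first uncountable ordinal (so its elements are the countable ordinals). Finite types are generated from a base type $o$ by $\sigma,\tau\mapsto\sigma\to\tau$. The hereditarily monotone type structure over $\Omega$: $\Omega^{\mathrm{mon}}_o=\Omega$ with the usual order; $\Omega^{\mathrm{mon}}_{\sigma\to\tau}$ is the set of all monotone functions $f:\Omega^{\mathrm{mon}}_\sigma\to\Omega^{\mathrm{mon}}_\tau$ ($x\le y$ implies $f(x)\le f(y)$), ordered pointwise. Suprema and infima with respect to this order are computed pointwise; countable suprema and nonempty infima exist. For a nonzero countable ordinal $\zeta$ and a family $\{x_\xi\}_{\xi<\zeta}$, $\limsup_{\xi\to\zeta}\{x_\xi\}=\inf_{\gamma<\zeta}\sup_{\gamma\le\xi<\zeta}x_\xi$. For each type $\sigma$ and countable ordinal $\alpha$, the iteration functional $I_\alpha^\sigma$ takes $f\in\Omega^{\mathrm{mon}}_{\sigma\to\sigma}$ and $x\in\Omega^{\mathrm{mon}}_\sigma$ and is defined by recursion (application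 associates to the left): $I_0^\sigma fx=x$; $I_{\alpha+1}^\sigma fx=f(I_\alpha^\sigma fx)$; $I_\mu^\sigma fx=\limsup_{\xi\to\mu}\{I_\xi^\sigma fx\}$ for limit $\mu$. One has $I_\alpha^\sigma\in\Omega^{\mathrm{mon}}_{(\sigma\to\sigma)\to(\sigma\to\sigma)}$, so the expressions in the claim make sense. Ordinal arithmetic conventions: $\gamma\alpha$ is the product with $\gamma(\delta+1)=\gamma\delta+\gamma$ (so $2\omega=\omega$); $\gamma^{\delta+1}=\gamma^\delta\gamma$, $\gamma^0=1$, and $0^\alpha=0$ for every $\alpha>0$. *)

(* Defs.v *)
From HB Require Import structures.
From mathcomp Require Import all_boot all_order.
From mathcomp Require Import boolp classical_sets functions cardinality wochoice.

Set Implicit Arguments.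
Unset Strict Implicit.
Unset Printing Implicit Defensive.

Import Order.TTheory.

Local Open Scope order_scope.
Local Open Scope classical_set_scope.

(* Omega is the initial segment of all points with countably many predecessors
   in a fixed well-ordering of the uncountable type [set nat].  Lemmas
   [Omega_wo], [Omega_uncountable] and [Omega_initial_countable] below say that
   it has order type omega_1, which determines it up to unique isomorphism. *)
Definition wo_rel : rel (set nat) := sval (well_ordering_principle (set nat)).

Definition Omega := {x : set nat | countable [set y | wo_rel y x]}.

HB.instance Definition _ := gen_eqMixin Omega.
HB.instance Definition _ := gen_choiceMixin Omega.

Definition leO : rel Omega := fun x y => wo_rel (sval x) (sval y).

Lemma sval_Omega_inj : injective (sval : Omega -> set nat).
Proof. by move=> [x cx] [y cy] /= xy; exact: eq_exist. Qed.

Lemma wo_relP (A : set (set nat)) :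
  A !=set0 -> exists x, A x /\ forall y, A y -> wo_rel x y.
Proof.
move=> [x Ax]; rewrite /wo_rel.
case: (well_ordering_principle _) => R /= /(_ (mem A)) [|z [[zA zmin] _]].
  by exists x; rewrite inE.
by exists z; split=> [|y Ay]; [move: zA; rewrite inE|apply: zmin; rewrite inE].
Qed.

Lemma wo_rel_total : total wo_rel.
Proof.
move=> x y; have [|z [[->|->] /= zmin]] := @wo_relP [set x; y].
- by exists x; left.
- by rewrite zmin //; right.
- by rewrite orbC zmin //; left.
Qed.

Lemma wo_rel_refl : reflexive wo_rel.
Proof. by move=> x; have := wo_rel_total x x; rewrite orbb. Qed.

Lemma wo_rel_anti : antisymmetric wo_rel.
Proof.
rewrite /wo_rel; case: (well_ordering_principle _) => R /= Rwo x y /andP[xy yx].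
have refl : reflexive R.
  move=> z; have [|w [[+ wmin] _]] := Rwo (pred1 z); first by exists z; rewrite inE.
  rewrite -topredE /= => /eqP wz.
  by subst w; apply: wmin; exact: eqxx.
have [|w [_ wu]] := Rwo (mem [set x; y]).
  by exists x; rewrite inE; left.
transitivity w; last first.
  by apply: wu; split=> [|t]; rewrite inE; [right|case=> ->].
by symmetry; apply: wu; split=> [|t]; rewrite inE; [left|case=> ->].
Qed.

Lemma wo_rel_trans : transitive wo_rel.
Proof.
move=> y x z xy yz.
have [|w [ww wmin]] := @wo_relP [set t | t = x \/ t = y \/ t = z].
  by exists x; left.
have wx : wo_rel w x by apply: wmin; left.
have wy : wo_rel w y by apply: wmin; right; left.
have wz : wo_rel w z by apply: wmin; right; right.
case: ww => [<- //|[wE|wE]]; subst w.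
- by have -> : x = y by apply: wo_rel_anti; rewrite xy wx.
- have zy : z = y by apply: wo_rel_anti; rewrite wy yz.
  by rewrite -zy in xy *.
Qed.

Lemma leO_refl : reflexive leO. Proof. by move=> x; exact: wo_rel_refl. Qed.
Lemma leO_anti : antisymmetric leO.
Proof. by move=> x y /wo_rel_anti/sval_Omega_inj. Qed.
Lemma leO_trans : transitive leO.
Proof. by move=> y x z; exact: wo_rel_trans. Qed.
Lemma leO_total : total leO. Proof. by move=> x y; exact: wo_rel_total. Qed.

Fact mon_display : Order.disp_t. Proof. exact: Order.Disp tt tt. Qed.

HB.instance Definition _ :=
  Order.Le_isPOrder.Build mon_display Omega leO_refl leO_anti leO_trans.
HB.instance Definition _ :=
  Order.POrder_isTotal.Build mon_display Omega leO_total.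

Lemma Omega_wo (A : set Omega) : A !=set0 -> exists x, A x /\ lbound A x.
Proof.
move=> [x Ax]; have [|z [[y Ay <-] ymin]] := @wo_relP (sval @` A).
  by exists (sval x), x.
by exists y; split=> // t At; apply: ymin; exists t.
Qed.

Lemma Omega_initial_countable (x : Omega) : countable [set y | y <= x].
Proof.
apply: (@sub_countable _ _ _ [set y | wo_rel y (sval x)]); last first.
  exact: svalP x.
apply/pcard_leP; apply/injfunPex; exists val => //.
by move=> s t _ _ /val_inj.
Qed.

Lemma set_nat_uncountable : ~ countable [set: set nat].
Proof.
move=> /countable_injP[f finj].
pose D := [set n | exists A : set nat, f A = n /\ ~ A n].
have [DD|nDD] := pselect (D (f D)); last by apply: (nDD); exists D.
have [A [fA nA]] := DD.
by apply: nA; rewrite (finj _ _ _ _ fA) ?inE.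
Qed.

Lemma Omega_uncountable : ~ countable [set: Omega].
Proof.
move=> cO.
pose A := [set x | countable [set y | wo_rel y x]].
have cA : countable A.
  apply: sub_countable cO; apply/pcard_geP/surjPex; exists sval => x Ax.
  by exists (exist _ x Ax).
have [AT|] := pselect (forall x, A x).
  by apply: set_nat_uncountable; rewrite (_ : setT = A) //; apply/seteqP; split=> x _.
move=> /existsNP[x0 nx0].
have [|x [nx xmin]] := @wo_relP (~` A); first by exists x0.
apply: nx; rewrite /A /=.
have cAx : countable (A `|` [set x]).
  rewrite (_ : _ `|` _ = \bigcup_(i in [set: bool]) (if i then A else [set x])).
    apply: bigcup_countable; first exact: countableP.
    by case=> _ //; exact: countable1.
  apply/seteqP; split=> [y [Ay|yx]|y [[] _ yi]].
  - by exists true.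
  - by exists false.
  - by left.
  - by right.
apply: sub_countable cAx; apply: subset_card_le => y /= yx.
have [Ay|/xmin xy] := pselect (A y); first by left.
by right; apply: wo_rel_anti; rewrite yx xy.
Qed.

Lemma Omega_wf : well_founded (fun x y : Omega => x < y).
Proof.
move=> a; apply: contrapT => na.
have [|x [nx xmin]] := @Omega_wo [set x | ~ Acc (fun x y : Omega => x < y) x].
  by exists a.
apply: nx; constructor => y yx; apply: contrapT => /xmin.
by rewrite leNgt yx.
Qed.

Lemma Omega_bottom : {x : Omega | forall y, x <= y}.
Proof.
apply: cid; have [|x [_ xmin]] := @Omega_wo setT.
  by apply/set0P/eqP => O0; apply: Omega_uncountable; rewrite O0; exact: countable0.
by exists x => y; exact: xmin.
Qed.

HB.instance Definition _ :=
  Order.hasBottom.Build mon_display Omega (svalP Omega_bottom).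

Lemma Omega_countable_ubound (A : set Omega) :
  countable A -> exists b, forall a, A a -> a < b.
Proof.
move=> cA; apply: contrapT => /forallNP nb; apply: Omega_uncountable.
rewrite (_ : setT = \bigcup_(a in A) [set y | y <= a]).
  by apply: bigcup_countable => // a _; exact: Omega_initial_countable.
apply/seteqP; split=> // b _; have /existsNP[a /not_implyP[Aa /negP]] := nb b.
by rewrite -leNgt => ba; exists a.
Qed.

Definition countably_complete d (T : porderType d) :=
  (forall A : set T, countable A -> A !=set0 -> supremums A !=set0) /\
  (forall A : set T, A !=set0 -> infimums A !=set0).

Lemma supremumP d (T : porderType d) (x0 : T) (A : set T) :
  A !=set0 -> supremums A !=set0 -> supremums A (supremum x0 A).
Proof. by move=> /set0P A0 [y Ay]; rewrite /supremum (negPf A0); exact: xgetI Ay. Qed.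

Lemma infimumP d (T : porderType d) (x0 : T) (A : set T) :
  A !=set0 -> infimums A !=set0 -> infimums A (infimum x0 A).
Proof. by move=> /set0P A0 [y Ay]; rewrite /infimum (negPf A0); exact: xgetI Ay. Qed.

Lemma Omega_complete : @countably_complete _ Omega.
Proof.
split=> A.
  move=> cA _; have [b bub] := Omega_countable_ubound cA.
  have [|x [ux xmin]] := @Omega_wo (ubound A).
    by exists b => a /bub /ltW.
  by exists x.
move=> /Omega_wo[x [Ax xmin]]; exists x; split=> // y; exact.
Qed.

Definition osucc (a : Omega) : Omega := infimum a [set b | a < b].

Lemma osuccP a b : (osucc a <= b) = (a < b).
Proof.
have A0 : [set b | a < b] !=set0.
  have [c cub] := Omega_countable_ubound (@countable1 _ a).
  by exists c; apply: cub.
have [x [ax xmin]] := Omega_wo A0.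
have [lo gr] := infimumP a A0 (proj2 Omega_complete _ A0).
rewrite -/(osucc a) in lo gr.
have -> : osucc a = x.
  by apply/eqP; rewrite eq_le lo //= gr.
by apply/idP/idP => [xb|/xmin //]; exact: lt_le_trans xb.
Qed.

Lemma osucc_inj : injective osucc.
Proof.
suff h a b : osucc a = osucc b -> a <= b.
  by move=> a b ab; apply/eqP; rewrite eq_le !h.
by move=> ab; rewrite leNgt -osuccP -ab osuccP ltxx.
Qed.

Definition is_limit (a : Omega) := a != \bot /\ forall b, a <> osucc b.

Section Recursion.
Variables (T : Type) (x0 : T) (s : T -> T) (l : Omega -> (Omega -> T) -> T).

Definition ord_step (a : Omega) (g : Omega -> T) : T :=
  if a == \bot then x0
  else if pselect (exists b, a = osucc b) is left e then s (g (sval (cid e)))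
  else l a g.

(* The values already computed, completed by [x0] from [a] on. *)
Definition ord_ext (a : Omega) (r : forall b, b < a -> T) (b : Omega) : T :=
  if pselect (b < a) is left h then r b h else x0.

Definition ord_rec : Omega -> T :=
  Fix Omega_wf (fun _ => T) (fun a r => ord_step a (ord_ext r)).

Lemma ord_recE a :
  ord_rec a = ord_step a (fun b => if b < a then ord_rec b else x0).
Proof.
rewrite {1}/ord_rec Fix_eq => [|{}a f g fg].
  congr ord_step; apply/funext => b; rewrite /ord_ext.
  by case: pselect => [/= ->//|/negP/negPf ->].
congr ord_step; apply/funext => b; rewrite /ord_ext.
by case: pselect => // h; rewrite fg.
Qed.

Lemma ord_rec0 : ord_rec \bot = x0.
Proof. by rewrite ord_recE /ord_step eqxx. Qed.

Lemma ord_recS a : ord_rec (osucc a) = s (ord_rec a).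
Proof.
have aS : a < osucc a by rewrite -osuccP.
rewrite ord_recE /ord_step gt_eqF; last exact: le_lt_trans (le0x a) aS.
case: pselect => [e|[]]; last by exists a.
by case: cid => b /= /osucc_inj <-; rewrite aS.
Qed.

Lemma ord_recL a : is_limit a ->
    (forall g h, (forall b, b < a -> g b = h b) -> l a g = l a h) ->
  ord_rec a = l a ord_rec.
Proof.
move=> [a0 aS] la; rewrite ord_recE /ord_step (negPf a0).
case: pselect => [e|_]; first by exfalso; case: e => b /aS.
by apply: la => b ->.
Qed.

End Recursion.

Lemma ord_ind (P : Omega -> Prop) :
  P \bot -> (forall a, P a -> P (osucc a)) ->
  (forall a, is_limit a -> (forall b, b < a -> P b) -> P a) -> forall a, P a.
Proof.
move=> P0 PS PL; apply: (well_founded_ind Omega_wf) => a IH.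
have [->//|a0] := eqVneq a \bot.
have [[b ab]|nS] := pselect (exists b, a = osucc b).
  by rewrite ab; apply/PS/IH; rewrite ab -osuccP.
by apply: PL => //; split=> // b ab; apply: nS; exists b.
Qed.

Definition sup_below (m : Omega) (x : Omega -> Omega) : Omega :=
  supremum \bot [set x xi | xi in [set xi | xi < m]].

Lemma eq_sup_below m x y : (forall xi, xi < m -> x xi = y xi) ->
  sup_below m x = sup_below m y.
Proof. by move=> xy; congr supremum; apply: eq_imagel => xi /xy. Qed.

Definition oone : Omega := osucc \bot.

Definition oadd (c a : Omega) : Omega := ord_rec c osucc sup_below a.

Definition omul (c a : Omega) : Omega :=
  ord_rec \bot (fun d => oadd d c) sup_below a.

(* At a limit the supremum of the lower powers of 0 would be 1, because
   0^0 = 1; hence the separate clause for 0^a = 0 (a > 0). *)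
Definition oexp (c a : Omega) : Omega :=
  if (c == \bot) && (a != \bot) then \bot
  else ord_rec oone (fun d => omul d c) sup_below a.

Lemma oadd0 c : oadd c \bot = c. Proof. exact: ord_rec0. Qed.
Lemma oaddS c a : oadd c (osucc a) = osucc (oadd c a).
Proof. exact: ord_recS. Qed.
Lemma oaddL c a : is_limit a -> oadd c a = sup_below a (oadd c).
Proof. by move=> la; apply: ord_recL => // g h; exact: eq_sup_below. Qed.

Lemma omul0 c : omul c \bot = \bot. Proof. exact: ord_rec0. Qed.
Lemma omulS c a : omul c (osucc a) = oadd (omul c a) c.
Proof. exact: ord_recS. Qed.
Lemma omulL c a : is_limit a -> omul c a = sup_below a (omul c).
Proof. by move=> la; apply: ord_recL => // g h; exact: eq_sup_below. Qed.

Lemma oexp0 c : oexp c \bot = oone.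
Proof. by rewrite /oexp eqxx andbF; exact: ord_rec0. Qed.
Lemma oexpS c a : oexp c (osucc a) = omul (oexp c a) c.
Proof.
rewrite /oexp; case: eqVneq => [->|_] /=; last exact: ord_recS.
have -> : osucc a != \bot.
  by rewrite gt_eqF // (le_lt_trans (le0x a)) // -osuccP.
by rewrite omul0.
Qed.
Lemma oexp0n a : a != \bot -> oexp \bot a = \bot.
Proof. by rewrite /oexp eqxx => ->. Qed.
Lemma oexpL c a : c != \bot -> is_limit a -> oexp c a = sup_below a (oexp c).
Proof.
move=> c0 la; rewrite {1}/oexp (negPf c0) /=.
rewrite ord_recL //; last by move=> g h; exact: eq_sup_below.
by apply: eq_sup_below => xi _; rewrite /oexp (negPf c0).
Qed.

Section MonotoneFunctions.
Context {d d' : Order.disp_t} {T : porderType d} {T' : porderType d'}.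
Implicit Types f g : {omorphism T -> T'}.

Lemma omorphism_ext f g : (forall x, f x = g x) -> f = g.
Proof.
case: f g => f [[fm]] [g [[gm]]] /= fg.
have {}fg : f = g by apply/funext.
by subst g; rewrite (Prop_irrelevance fm gm).
Qed.

Definition omorphism_of (f : T -> T') (fm : {homo f : x y / x <= y}) :
    {omorphism T -> T'} :=
  HB.pack f (Order.isOrderMorphism.Build d T d' T' f fm).

Definition le_omorphism : rel {omorphism T -> T'} :=
  fun f g => `[< forall x, f x <= g x >].

Lemma le_omorphism_refl : reflexive le_omorphism.
Proof. by move=> f; apply/asboolP. Qed.
Lemma le_omorphism_anti : antisymmetric le_omorphism.
Proof.
move=> f g /andP[/asboolP fg /asboolP gf].
by apply: omorphism_ext => x; apply/eqP; rewrite eq_le fg gf.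
Qed.
Lemma le_omorphism_trans : transitive le_omorphism.
Proof.
move=> g f h /asboolP fg /asboolP gh; apply/asboolP => x.
exact: le_trans (fg x) (gh x).
Qed.

HB.instance Definition _ := gen_eqMixin {omorphism T -> T'}.
HB.instance Definition _ := gen_choiceMixin {omorphism T -> T'}.
HB.instance Definition _ := Order.Le_isPOrder.Build d' {omorphism T -> T'}
  le_omorphism_refl le_omorphism_anti le_omorphism_trans.

Lemma le_omorphismP f g : f <= g <-> forall x, f x <= g x.
Proof. by split=> [/asboolP|?]; last exact/asboolP. Qed.

Lemma omorphism_complete :
  countably_complete T' -> countably_complete {omorphism T -> T'}.
Proof.
move=> [csup cinf]; split=> A.
- move=> cA [f0 Af0].
  pose B x := [set f x | f in A].
  have BP x : supremums (B x) (supremum (f0 x) (B x)).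
    have B0 : B x !=set0 by exists (f0 x), f0.
    by apply: supremumP => //; apply: csup => //; exact: card_le_trans (card_image_le _ _) cA.
  have sm : {homo (fun x => supremum (f0 x) (B x)) : x y / x <= y}.
    move=> x y xy; apply: (BP x).2 => _ [f Af <-].
    by apply: le_trans (omorph_le f xy) _; apply: (BP y).1; exists f.
  exists (omorphism_of sm); split=> [f Af|g gub]; apply/le_omorphismP => x /=.
    by apply: (BP x).1; exists f.
  by apply: (BP x).2 => _ [f Af <-]; apply: (le_omorphismP _ _).1; exact: gub.
- move=> [f0 Af0].
  pose B x := [set f x | f in A].
  have BP x : infimums (B x) (infimum (f0 x) (B x)).
    have B0 : B x !=set0 by exists (f0 x), f0.
    by apply: infimumP => //; exact: cinf.
  have sm : {homo (fun x => infimum (f0 x) (B x)) : x y / x <= y}.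
    move=> x y xy; apply: (BP y).2 => _ [f Af <-].
    by apply: le_trans _ (omorph_le f xy); apply: (BP x).1; exists f.
  exists (omorphism_of sm); split=> [f Af|g glb]; apply/le_omorphismP => x /=.
    by apply: (BP x).1; exists f.
  by apply: (BP x).2 => _ [f Af <-]; apply: (le_omorphismP _ _).1; exact: glb.
Qed.

End MonotoneFunctions.

Inductive ty := Base | Arrow of ty & ty.

Fixpoint Omon (s : ty) : porderType mon_display :=
  match s with
  | Base => Omega
  | Arrow s t => {omorphism Omon s -> Omon t}
  end.

Lemma Omon_complete s : countably_complete (Omon s).
Proof.
elim: s => [|s _ t IH]; [exact: Omega_complete|exact: omorphism_complete].
Qed.

(* Only the values of [x] below [z] matter, and for [z != \bot] the default
   value [x \bot] is never used, since the suprema and infima exist. *)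
Definition limsup d (T : porderType d) (z : Omega) (x : Omega -> T) : T :=
  infimum (x \bot)
    [set supremum (x \bot) [set x xi | xi in [set xi | g <= xi < z]]
       | g in [set g | g < z]].

Lemma eq_limsup d (T : porderType d) z (x y : Omega -> T) :
  z != \bot -> (forall xi, xi < z -> x xi = y xi) -> limsup z x = limsup z y.
Proof.
rewrite -lt0x => z0 xy; rewrite /limsup xy //; congr infimum.
apply: eq_imagel => g _; congr supremum.
by apply: eq_imagel => xi /andP[_ /xy].
Qed.

Lemma limsup_supP s (z : Omega) (x : Omega -> Omon s) (x0 : Omon s) g : g < z ->
  let A := [set x xi | xi in [set xi | g <= xi < z]] in
  supremums A (supremum x0 A).
Proof.
move=> gz A; have A0 : A !=set0 by exists (x g), g => //=; rewrite lexx.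
apply: supremumP => //; apply: (Omon_complete s).1 => //.
apply: card_le_trans (card_image_le _ _) _.
apply: sub_countable (Omega_initial_countable z).
by apply: subset_card_le => xi /andP[_ /ltW].
Qed.

Lemma limsupP s (z : Omega) (x : Omega -> Omon s) : z != \bot ->
  infimums [set supremum (x \bot) [set x xi | xi in [set xi | g <= xi < z]]
              | g in [set g | g < z]] (limsup z x).
Proof.
rewrite -lt0x => z0; apply: infimumP.
  by eexists; exists \bot => //=.
by apply: (Omon_complete s).2; eexists; exists \bot => //=.
Qed.

Lemma le_limsup s (z : Omega) (x y : Omega -> Omon s) : z != \bot ->
  (forall xi, xi < z -> x xi <= y xi) -> limsup z x <= limsup z y.
Proof.
move=> z0 xy; apply: (limsupP y z0).2 => _ [g gz <-].
apply: (@le_trans _ _ (supremum (x \bot) [set x xi | xi in [set xi | g <= xi < z]])).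
  by apply: (limsupP x z0).1; exists g.
apply: (limsup_supP x (x \bot) gz).2 => _ [xi /andP[gxi xiz] <-].
apply: le_trans (xy _ xiz) _; apply: (limsup_supP y (y \bot) gz).1.
by exists xi => //=; rewrite gxi.
Qed.

Definition iter_fun s (a : Omega) (f : Omon s -> Omon s) (x : Omon s) : Omon s :=
  ord_rec x f (@limsup _ (Omon s)) a.

Lemma iter_fun0 s f x : @iter_fun s \bot f x = x.
Proof. exact: ord_rec0. Qed.
Lemma iter_funS s a f x :
  @iter_fun s (osucc a) f x = f (@iter_fun s a f x).
Proof. exact: ord_recS. Qed.
Lemma iter_funL s m f x : is_limit m ->
  @iter_fun s m f x = limsup m (fun xi => @iter_fun s xi f x).
Proof.
by move=> lm; apply: ord_recL => // g h; apply: eq_limsup; case: lm.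
Qed.

Lemma le_iter_fun s a (f g : {omorphism Omon s -> Omon s}) (x y : Omon s) :
  f <= g -> x <= y -> @iter_fun s a f x <= @iter_fun s a g y.
Proof.
move=> /le_omorphismP fg xy; elim/ord_ind: a => [|a IH|a la IH].
- by rewrite !iter_fun0.
- by rewrite !iter_funS; apply: le_trans (fg _) (omorph_le g IH).
- by rewrite !iter_funL //; apply: le_limsup => //; case: la.
Qed.

Lemma iter_fun_homo s a (f : {omorphism Omon s -> Omon s}) :
  {homo @iter_fun s a f : x y / x <= y}.
Proof. by move=> x y; exact: le_iter_fun. Qed.

Definition iter_omorphism s a (f : Omon (Arrow s s)) : Omon (Arrow s s) :=
  omorphism_of (iter_fun_homo a f).

Lemma iter_omorphism_homo s a : {homo @iter_omorphism s a : f g / f <= g}.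
Proof. by move=> f g fg; apply/le_omorphismP => x; exact: le_iter_fun. Qed.

Definition Iter s (a : Omega) : Omon (Arrow (Arrow s s) (Arrow s s)) :=
  omorphism_of (@iter_omorphism_homo s a).

Lemma IterE s a (f : Omon (Arrow s s)) (x : Omon s) :
  Iter s a f x = iter_fun a f x.
Proof. by []. Qed.

(* Main.v *)
(* For fixed [x], the totality of the order gives [x <= f x] or [f x <= x], so
   the transfinite sequence [I_xi f x] is monotone in [xi] (increasing or
   decreasing).  The limsup of such a sequence at a limit is its supremum,
   respectively its infimum, and may therefore be computed along any
   nondecreasing reindexing [h] of the ordinals: the limsup of [I_(h xi) f x]
   is [I_s f x] with [s] the supremum of the [h xi].  Taking for [h] the maps
   [gamma + _], [gamma * _] and [gamma ^ _] gives the limit steps of three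
   inductions on [alpha]; the powers of [0] are not monotone in the exponent,
   but they are eventually constant. *)
Require Import Defs.
From mathcomp Require Import all_boot all_order.
From mathcomp Require Import boolp classical_sets cardinality.

Set Implicit Arguments.
Unset Strict Implicit.
Unset Printing Implicit Defensive.

Import Order.TTheory.

Local Open Scope order_scope.
Local Open Scope classical_set_scope.

(** * Limit ordinals, suprema, and monotonicity of the arithmetic operations *)

Lemma ltOS (a : Omega) : a < osucc a.
Proof. by rewrite -osuccP. Qed.

Lemma limit_osucc_lt (m a : Omega) : is_limit m -> a < m -> osucc a < m.
Proof.
by move=> [_ mS] am; rewrite lt_neqAle osuccP am andbT eq_sym; apply/eqP/mS.
Qed.

Lemma limit_gt0 (m : Omega) : is_limit m -> \bot < m.
Proof. by move=> [m0 _]; rewrite lt0x. Qed.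

Lemma sup_belowP (m c : Omega) (h : Omega -> Omega) : \bot < m ->
  sup_below m h <= c <-> forall a, a < m -> h a <= c.
Proof.
move=> m0; pose A := [set h xi | xi in [set xi | xi < m]].
have A0 : A !=set0 by exists (h \bot), \bot.
have cA : countable A.
  apply: card_le_trans (card_image_le _ _) _.
  apply: sub_countable (Omega_initial_countable m).
  by apply: subset_card_le => xi /ltW.
have [ub lub] := supremumP \bot A0 (Omega_complete.1 A cA A0).
split=> [sc a am|hc]; last by apply: lub => _ [a am <-]; exact: hc.
by apply: le_trans sc; apply: ub; exists a.
Qed.

Lemma sup_below_ge (m a : Omega) (h : Omega -> Omega) :
  a < m -> h a <= sup_below m h.
Proof.
move=> am; have m0 : \bot < m by exact: le_lt_trans (le0x a) am.
by have /(sup_belowP _ h m0) := lexx (sup_below m h); apply.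
Qed.

Lemma nondecreasing_of_step (h : Omega -> Omega) :
  (forall a, h a <= h (osucc a)) ->
  (forall m, is_limit m -> h m = sup_below m h) ->
  {homo h : a b / a <= b}.
Proof.
move=> hS hL a; elim/ord_ind => [|b IH|m lm _].
- by rewrite lex0 => /eqP ->.
- rewrite le_eqVlt => /orP[/eqP -> //|].
  by rewrite ltNge osuccP -leNgt => /IH /le_trans; apply.
- by rewrite le_eqVlt => /orP[/eqP -> //|am]; rewrite (hL m) // sup_below_ge.
Qed.

Lemma oadd_homo (c : Omega) : {homo oadd c : a b / a <= b}.
Proof.
apply: nondecreasing_of_step => [a|m]; last exact: oaddL.
by rewrite oaddS ltW // ltOS.
Qed.

Lemma oadd_ger (a c : Omega) : a <= oadd c a.
Proof.
elim/ord_ind: a => [|a IH|m lm IH]; first exact: le0x.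
  by rewrite oaddS osuccP (le_lt_trans IH) // ltOS.
(* If [c + m < m], the hypothesis at [b = (c + m) + 1 < m] gives [c + m < b <= c + b], against
   [c + b <= c + m]. *)
rewrite leNgt; apply/negP => cm; have := IH _ (limit_osucc_lt lm cm).
by rewrite osuccP ltNge (oadd_homo c (ltW (limit_osucc_lt lm cm))).
Qed.

Lemma omul_homo (c : Omega) : {homo omul c : a b / a <= b}.
Proof.
apply: nondecreasing_of_step => [a|m]; last exact: omulL.
by rewrite omulS -{1}[omul c a]oadd0 oadd_homo // le0x.
Qed.

(** For nonzero [c], the successor step is [c^a <= c^a * 1 <= c^a * c]. *)
Lemma oexp_homo (c : Omega) : c != \bot -> {homo oexp c : a b / a <= b}.
Proof.
move=> c0; apply: nondecreasing_of_step => [a|m]; last exact: oexpL.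
rewrite oexpS; apply: (@le_trans _ _ (omul (oexp c a) oone)).
  by rewrite omulS omul0 oadd_ger.
by apply: omul_homo; rewrite osuccP lt0x.
Qed.

(** * Monotone transfinite sequences, with a flag for the direction so that one argument serves
    both *)

Definition dle d (T : porderType d) (up : bool) (x y : T) :=
  if up then x <= y else y <= x.

Section DirectedLe.
Context {d : Order.disp_t} {T : porderType d}.
Implicit Types (up : bool) (x y z : T).

Lemma dle_refl up x : dle up x x.
Proof. by case: up; rewrite /dle. Qed.

Lemma dle_trans up y x z : dle up x y -> dle up y z -> dle up x z.
Proof. by case: up => xy yz; [exact: le_trans xy yz|exact: le_trans yz xy]. Qed.

Lemma dle_anti up x y : dle up x y -> dle up y x -> x = y.
Proof. by case: up => /= xy yx; apply/le_anti; rewrite xy yx. Qed.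

End DirectedLe.

(** This is the universal property of a supremum when [up] holds, and of an infimum otherwise. *)
Lemma dle_limsupP s up (m : Omega) (y : Omega -> Omon s) :
  m != \bot ->
  (forall a b, a <= b -> b < m -> dle up (y a) (y b)) ->
  forall c, dle up (limsup m y) c <-> forall a, a < m -> dle up (y a) c.
Proof.
move=> m0 ymono c; have [lo gr] := limsupP y m0.
have gem a : a < m -> limsup m y <=
    supremum (y \bot) [set y xi | xi in [set xi | a <= xi < m]].
  by move=> am; apply: lo; exists a.
case: up ymono => /= ymono; split.
- move=> yc a am; apply: le_trans yc; apply: gr => _ [g gm <-].
  have [ub _] := limsup_supP y (y \bot) gm.
  have [ag|/ltW ga] := leP a g.
    by apply: le_trans (ymono _ _ ag gm) _; apply: ub; exists g; rewrite //= lexx.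
  by apply: ub; exists a; rewrite //= ga.
- move=> yc; rewrite -lt0x in m0; apply: le_trans (gem _ m0) _.
  apply: (limsup_supP y (y \bot) m0).2 => _ [a /andP[_ am] <-]; exact: yc.
- move=> yc a am; apply: le_trans yc _; apply: le_trans (gem _ am) _.
  apply: (limsup_supP y (y \bot) am).2 => _ [b /andP[ab bm] <-]; exact: ymono.
- move=> yc; apply: gr => _ [g gm <-]; apply: le_trans (yc _ gm) _.
  by apply: (limsup_supP y (y \bot) gm).1; exists g; rewrite //= lexx.
Qed.

Lemma dle_iter_fun s up (f : Omon (Arrow s s)) (x : Omon s) :
  dle up x (f x) -> forall a b, a <= b -> dle up (iter_fun a f x) (iter_fun b f x).
Proof.
move=> xfx a b; move: b a.
have fmono y z : dle up y z -> dle up (f y) (f z).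
  by case: up {xfx} => yz; exact: omorph_le.
(* The induction also carries the comparison of [I_b f x] with its image under [f], which drives the
   successor step. *)
suff H b : dle up (iter_fun b f x) (f (iter_fun b f x)) /\
    forall a, a <= b -> dle up (iter_fun a f x) (iter_fun b f x).
  by move=> b; apply: (H b).2.
elim/ord_ind: b => [|b [bS IH]|m lm IH].
- split=> [|a]; first by rewrite iter_fun0.
  by rewrite lex0 => /eqP ->; exact: dle_refl.
- rewrite iter_funS; split=> [|a]; first exact: fmono.
  rewrite le_eqVlt => /orP[/eqP ->|]; first by rewrite iter_funS; exact: dle_refl.
  by rewrite ltNge osuccP -leNgt => /IH /dle_trans; apply.
- have mono a b : a <= b -> b < m -> dle up (iter_fun a f x) (iter_fun b f x).
    by move=> ab bm; apply: (IH b bm).2.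
  have limP := dle_limsupP lm.1 mono.
  have ub a : a < m -> dle up (iter_fun a f x) (iter_fun m f x).
    by move: a; apply/limP; rewrite iter_funL //; exact: dle_refl.
  split=> [|a].
    (* No continuity of [f] is required: in the direction of [up], [I_a f x] precedes [f (I_a f x)],
       which precedes [f (I_m f x)]. *)
    rewrite {1}iter_funL //; apply/limP => a am.
    exact: dle_trans (IH a am).1 (fmono _ _ (ub a am)).
  by rewrite le_eqVlt => /orP[/eqP ->|/ub //]; exact: dle_refl.
Qed.

Lemma limsup_iter_fun s up (f : Omon (Arrow s s)) (x : Omon s)
    (m : Omega) (h : Omega -> Omega) :
  dle up x (f x) -> m != \bot -> {homo h : a b / a <= b} ->
  limsup m (fun xi => iter_fun (h xi) f x) = iter_fun (sup_below m h) f x.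
Proof.
move=> xfx m0 hmono; have xmono := dle_iter_fun xfx.
have limP := @dle_limsupP _ up m (fun xi => iter_fun (h xi) f x) m0
  (fun a b ab _ => xmono _ _ (hmono _ _ ab)).
apply: (@dle_anti _ _ up).
  by apply/limP => a am; apply: xmono; exact: sup_below_ge.
set z := limsup _ _; have zub a : a < m -> dle up (iter_fun (h a) f x) z.
  by move: a; apply/limP; exact: dle_refl.
(* If [h] attains its supremum, that term already gives the bound. Otherwise the supremum is a limit
   ordinal in which the values of [h] are cofinal. *)
have [[a [am <-]]|nmax] := pselect (exists a, a < m /\ h a = sup_below m h).
  exact: zub.
have hlt a : a < m -> h a < sup_below m h.
  move=> am; rewrite lt_neqAle sup_below_ge // andbT.
  by apply/eqP => ha; apply: nmax; exists a.
have cofin c : c < sup_below m h -> exists2 a, a < m & c < h a.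
  move=> cs; apply: contrapT => nc; move: cs; rewrite ltNge => /negP; apply.
  apply/sup_belowP => [|a am]; first by rewrite lt0x.
  by rewrite leNgt; apply/negP => ca; apply: nc; exists a.
have lims : is_limit (sup_below m h).
  split=> [|c sc]; first by rewrite -lt0x (le_lt_trans (le0x _) (hlt \bot _)) // lt0x.
  (* If the supremum were [osucc c], some [h a] would exceed [c] and so reach it. *)
  have [|a am] := cofin c; first by rewrite sc ltOS.
  by rewrite -osuccP -sc leNgt hlt.
rewrite iter_funL //; apply/dle_limsupP => [|a b ab _|c /cofin[a am /ltW ca]].
- exact: lims.1.
- exact: xmono.
- exact: dle_trans (xmono _ _ ca) (zub a am).
Qed.

(** Totality of [Omega] supplies the direction; at higher types [x] and [f x] may be
    incomparable. *)
Lemma limsup_iter_Base (f : Omon (Arrow Base Base)) (x : Omega)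
    (m : Omega) (h : Omega -> Omega) :
  m != \bot -> {homo h : a b / a <= b} ->
  limsup m (fun xi => Iter Base (h xi) f x) = Iter Base (sup_below m h) f x.
Proof.
move=> m0 hmono; have [xf|/ltW fx] := leP x (f x : Omega).
  exact: (@limsup_iter_fun Base true).
exact: (@limsup_iter_fun Base false).
Qed.

(** Pointwise suprema and limsups of monotone functions are again monotone, so they compete with the
    abstract ones in the function space. This reduces limits at type [Arrow Base Base] to limits in
    [Omega]. *)
Lemma limsup_pointwise s t (m : Omega) (F : Omega -> Omon (Arrow s t))
    (x : Omon s) :
  m != \bot -> limsup m F x = limsup m (fun xi => F xi x).
Proof.
move=> m0.
have Lm : {homo (fun x => limsup m (fun xi => F xi x)) : x y / x <= y}.
  by move=> y z yz; apply: le_limsup => // xi _; exact: omorph_le.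
have [lo gr] := limsupP F m0.
suff -> : limsup m F = omorphism_of Lm by [].
apply/eqP; rewrite eq_le; apply/andP; split.
  apply/le_omorphismP => y /=.
  apply: (limsupP (fun xi => F xi y) m0).2 => _ [g gm <-].
  have supP z := limsup_supP (fun xi => F xi z) (F \bot z) gm.
  have Sm : {homo (fun z => supremum (F \bot z)
      [set F xi z | xi in [set xi | g <= xi < m]]) : z w / z <= w}.
    move=> z w zw; apply: (supP z).2 => _ [xi xig <-].
    by apply: le_trans (omorph_le (F xi) zw) _; apply: (supP w).1; exists xi.
  (* The pointwise supremum of the tail is an upper bound of it in the function space, hence lies
     above its supremum there. *)
  have : limsup m F <= omorphism_of Sm.
    apply: (@le_trans _ _ (supremum (F \bot) [set F xi | xi in [set xi | g <= xi < m]])).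
      by apply: lo; exists g.
    apply: (limsup_supP F (F \bot) gm).2 => _ [xi xig <-].
    by apply/le_omorphismP => z; apply: (supP z).1; exists xi.
  by move=> /le_omorphismP /(_ y).
apply: gr => _ [g gm <-]; apply/le_omorphismP => y.
apply: (@le_trans _ _ (supremum (F \bot y) [set F xi y | xi in [set xi | g <= xi < m]])).
  by apply: (limsupP (fun xi => F xi y) m0).1; exists g.
apply: (limsup_supP (fun xi => F xi y) (F \bot y) gm).2 => _ [xi xig <-].
by apply: (le_omorphismP _ _).1; apply: (limsup_supP F (F \bot) gm).1; exists xi.
Qed.

(** * The laws for sum, product and power *)

Lemma Iter0 s (f : Omon (Arrow s s)) x : Iter s \bot f x = x.
Proof. exact: iter_fun0. Qed.

Lemma IterS s a (f : Omon (Arrow s s)) x :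
  Iter s (osucc a) f x = f (Iter s a f x).
Proof. exact: iter_funS. Qed.

Lemma IterL s m (f : Omon (Arrow s s)) x : is_limit m ->
  Iter s m f x = limsup m (fun xi => Iter s xi f x).
Proof. exact: iter_funL. Qed.

Lemma Iter_oadd (f : Omon (Arrow Base Base)) (a c x : Omega) :
  Iter Base a f (Iter Base c f x) = Iter Base (oadd c a) f x.
Proof.
elim/ord_ind: a => [|a IH|m lm IH].
- by rewrite Iter0 oadd0.
- by rewrite IterS IH oaddS IterS.
- rewrite IterL // (eq_limsup lm.1 IH) limsup_iter_Base ?oaddL //; first exact: lm.1.
  exact: oadd_homo.
Qed.

Lemma Iter_omul (f : Omon (Arrow Base Base)) (a c x : Omega) :
  Iter Base a (Iter Base c f) x = Iter Base (omul c a) f x.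
Proof.
elim/ord_ind: a => [|a IH|m lm IH].
- by rewrite omul0 !Iter0.
- by rewrite IterS IH omulS Iter_oadd.
- rewrite IterL // (eq_limsup lm.1 IH) limsup_iter_Base ?omulL //; first exact: lm.1.
  exact: omul_homo.
Qed.

Lemma limsup_eventually_const s (m g : Omega) (y : Omega -> Omon s) (c : Omon s) :
  g < m -> (forall a, g <= a < m -> y a = c) -> limsup m y = c.
Proof.
move=> gm yc; have m0 : m != \bot by rewrite -lt0x (le_lt_trans (le0x g)).
have [lo gr] := limsupP y m0; apply/le_anti/andP; split.
  apply: (@le_trans _ _ (supremum (y \bot) [set y xi | xi in [set xi | g <= xi < m]])).
    by apply: lo; exists g.
  by apply: (limsup_supP y (y \bot) gm).2 => _ [xi /yc -> <-].
apply: gr => _ [k km <-]; apply: (limsup_supP y (y \bot) km).1.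
(* The maximum lies in the tail from [k] and in the constant range from [g]. *)
by exists (Order.max k g); rewrite /= ?yc ?le_max ?gt_max ?lexx ?orbT /= ?km.
Qed.

Lemma Iter_oexp (f : Omon (Arrow Base Base)) (a c x : Omega) :
  Iter (Arrow Base Base) a (Iter Base c) f x = Iter Base (oexp c a) f x.
Proof.
(* [x] is generalized because the successor step needs an equality of functions. *)
elim/ord_ind: a x => [|a IH|m lm IH] x.
- by rewrite Iter0 oexp0 IterS Iter0.
- rewrite IterS oexpS -Iter_omul; congr (Iter Base c _ x).
  exact: omorphism_ext.
- rewrite IterL // (@limsup_pointwise Base Base) ?lm.1 //.
  rewrite (eq_limsup lm.1 (fun b bm => IH b bm x)).
  have [->|c0] := eqVneq c \bot.
    (* The tail starts at [oone] to skip [0^0 = 1]; all later powers of 0 vanish. *)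
    rewrite (oexp0n lm.1); apply: (@limsup_eventually_const Base _ oone).
      exact: limit_osucc_lt lm (limit_gt0 lm).
    by move=> a; rewrite osuccP lt0x => /andP[a0 _]; rewrite oexp0n.
  rewrite limsup_iter_Base ?oexpL //; first exact: lm.1.
  exact: oexp_homo.
Qed.

Theorem theorem3p8 (f : Omon (Arrow Base Base)) (alpha gamma : Omega) :
  [/\ Iter Base alpha f \o Iter Base gamma f
        = Iter Base (oadd gamma alpha) f :> (Omega -> Omega),
      Iter Base alpha (Iter Base gamma f) = Iter Base (omul gamma alpha) f
    & Iter (Arrow Base Base) alpha (Iter Base gamma) f
        = Iter Base (oexp gamma alpha) f].
Proof.
split.
- by apply/funext => x; exact: Iter_oadd.
- by apply: omorphism_ext => x; exact: Iter_omul.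
- by apply: omorphism_ext => x; exact: Iter_oexp.
Qed.
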